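(* Let $R$ be an associative ring with unity $1$ and let $a,d,v,w,y\in R$ with at least one of $v$, $w$ invertible. Then the following statements are equivalent: (i) $y$ is the $(v,w)$-weighted inverse of $a$ along $d$. (ii) $yvawd=d=dvawy$, $Rwy\subseteq Rd$, and $lann(d)\subseteq lann(yv)$. (iii) $yvawy=y$, $Rwy=Rd$, and $lann(yv)=lann(d)$. (iv) $yvawd=d=dvawy$, $yvR\subseteq dR$, and $rann(wy)=rann(d)$. (v) $yvawy=y$, $yvR=dR$, and $rann(wy)=rann(d)$. (vi) $y$ is the hybrid $(v,w)$-weighted $(d,d)$-inverse of $a$. (vii) $y$ is the $(v,w)$-weighted $(d,d)$-inverse of $a$.
   Context: For $x\in R$: $xR=\{xr: r\in R\}$, $Rx=\{rx: r\in R\}$, $lann(x)=\{z\in R: zx=0\}$, $rann(x)=\{z\in R: xz=0\}$. Let $a,b,c,d,v,w\in R$. - $y\in R$ is the $(v,w)$-weighted inverse of $a$ along $d$ if $yvawd=d=dvawy$, $Rwy\subseteq Rd$ and $yvR\subseteq dR$. - $y\in R$ is the hybrid $(v,w)$-weighted $(b,c)$-inverse of $a$ if $yvawy=y$, $yvR=bR$ and $rann(c)=rann(wy)$. - $y\in R$ is the $(v,w)$-weighted $(b,c)$-inverse of $a$ if $y\in bRwy\cap yvRc$, $yvawb=b$ and $cvawy=c$. *)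

(* Defs.v *)
From HB Require Import structures.
From mathcomp Require Import all_boot all_algebra.
From mathcomp Require Import classical_sets.

Set Implicit Arguments.
Unset Strict Implicit.
Unset Printing Implicit Defensive.

Import GRing.Theory.

Local Open Scope ring_scope.
Local Open Scope classical_set_scope.

(* Two-sided invertibility; GRing.unit would restrict the ring to a
   unitRingType, i.e. assume that invertibility is decidable. *)
Definition invertible (R : pzRingType) (u : R) : Prop :=
  exists u', u' * u = 1 /\ u * u' = 1.

(* The sets xR, Rx and pRq = {p r q : r in R}. *)
Definition rideal (R : pzRingType) (x : R) : set R :=
  [set x * r | r in [set: R]].

Definition lideal (R : pzRingType) (x : R) : set R :=
  [set r * x | r in [set: R]].

Definition sandwich (R : pzRingType) (p q : R) : set R :=
  [set p * r * q | r in [set: R]].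

Definition lann (R : pzRingType) (x : R) : set R := [set z | z * x = 0].

Definition rann (R : pzRingType) (x : R) : set R := [set z | x * z = 0].

Definition weighted_inverse_along (R : pzRingType) (v w a d y : R) : Prop :=
  [/\ y * v * a * w * d = d, d = d * v * a * w * y,
      lideal (w * y) `<=` lideal d & rideal (y * v) `<=` rideal d].

Definition hybrid_weighted_bc_inverse (R : pzRingType) (v w b c a y : R) :
    Prop :=
  [/\ y * v * a * w * y = y, rideal (y * v) = rideal b
    & rann c = rann (w * y)].

Definition weighted_bc_inverse (R : pzRingType) (v w b c a y : R) : Prop :=
  [/\ (sandwich b (w * y) `&` sandwich (y * v) c) y,
      y * v * a * w * b = b & c * v * a * w * y = c].

(* Main.v *)
Require Import Defs.
From HB Require Import structures.
From mathcomp Require Import all_boot all_algebra.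
From mathcomp Require Import classical_sets.

Import GRing.Theory.

Local Open Scope ring_scope.
Local Open Scope classical_set_scope.

(* Each annihilator inclusion lets the one-sided identities [p * d = d] and
   [d * p = d] pass from [d] to [y * v] or [w * y]. This gives
   [y v a w y v = y v] and [w y v a w y = w y], and invertibility of [v] or [w]
   cancels one outer factor to yield [y v a w y = y]. Conversely, under (iii)
   or (vi) the element [d] is von Neumann regular, [d = d g d]; transporting
   [(d g) d = d] or [d (g d) = d] then turns the annihilator inclusion back
   into an inclusion of principal ideals. *)

Section PrincipalIdealsAndAnnihilators.

Set Implicit Arguments.
Unset Strict Implicit.

Variable R : pzRingType.
Implicit Types p v w x y z : R.

Lemma rideal_subP x y : rideal x `<=` rideal y <-> exists s, x = y * s.
Proof.
split=> [xy | [s ->] _ [r _ <-]]; last by exists (s * r); rewrite ?mulrA.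
have [|s _ <-] := xy x; last by exists s.
by exists 1; rewrite ?mulr1.
Qed.

Lemma lideal_subP x y : lideal x `<=` lideal y <-> exists s, x = s * y.
Proof.
split=> [xy | [s ->] _ [r _ <-]]; last by exists (r * s); rewrite ?mulrA.
have [|s _ <-] := xy x; last by exists s.
by exists 1; rewrite ?mul1r.
Qed.

Lemma lann_mul x y : lann x `<=` lann (x * y).
Proof. by move=> z /= zx0; rewrite /lann /= mulrA zx0 mul0r. Qed.

Lemma rann_mul x y : rann y `<=` rann (x * y).
Proof. by move=> z /= yz0; rewrite /rann /= -mulrA yz0 mulr0. Qed.

(** The element [p - 1] annihilates [x] on the left, hence also [y]. *)
Lemma lann_fix p x y : lann x `<=` lann y -> p * x = x -> p * y = y.
Proof.
move=> xy px; apply/subr0_eq; rewrite -{2}[y]mul1r -mulrBl.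
by apply: xy; rewrite /lann /= mulrBl mul1r px subrr.
Qed.

Lemma rann_fix p x y : rann x `<=` rann y -> x * p = x -> y * p = y.
Proof.
move=> xy xp; apply/subr0_eq; rewrite -{2}[y]mulr1 -mulrBr.
by apply: xy; rewrite /rann /= mulrBr mulr1 xp subrr.
Qed.

(** Both equations are assumed because it is not known which of [v] and [w] is the invertible
    one. *)
Lemma invertible_cancel v w x y :
  invertible v \/ invertible w -> w * x = w * y -> x * v = y * v -> x = y.
Proof.
case=> [[v' [_ vv']] _ xyv | [w' [w'w _]] wxy _].
  by rewrite -[x]mulr1 -[y]mulr1 -vv' !mulrA xyv.
by rewrite -[x]mul1r -[y]mul1r -w'w -!mulrA wxy.
Qed.

End PrincipalIdealsAndAnnihilators.

Theorem theorem4p9 (R : pzRingType) (a d v w y : R)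
    (hvw : invertible v \/ invertible w) :
  [<-> (* (i) *) weighted_inverse_along v w a d y;
       (* (ii) *) [/\ y * v * a * w * d = d, d = d * v * a * w * y,
           lideal (w * y) `<=` lideal d & lann d `<=` lann (y * v)];
       (* (iii) *) [/\ y * v * a * w * y = y, lideal (w * y) = lideal d
         & lann (y * v) = lann d];
       (* (iv) *) [/\ y * v * a * w * d = d, d = d * v * a * w * y,
           rideal (y * v) `<=` rideal d & rann (w * y) = rann d];
       (* (v) *) [/\ y * v * a * w * y = y, rideal (y * v) = rideal d
         & rann (w * y) = rann d];
       (* (vi) *) hybrid_weighted_bc_inverse v w d d a y;
       (* (vii) *) weighted_bc_inverse v w d d a y].
Proof.
tfae.
- case=> yd dy wyd /rideal_subP[s ys]; split=> //.
  by rewrite ys; exact: lann_mul.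
- case=> yd dy /lideal_subP[p wy] dyv.
  have yv : y * v * a * w * (y * v) = y * v by exact: lann_fix dyv yd.
  split.
  (* With [w * y = p * d], the equation multiplied by [w] on the left reduces to
     [d = d * v * a * w * y]. *)
  + apply: (invertible_cancel hvw); last by rewrite -[RHS]yv !mulrA.
    by rewrite !mulrA wy -!mulrA; congr (p * _); rewrite !mulrA -dy.
  + apply/seteqP; split; apply/lideal_subP; first by exists p.
    by exists (d * v * a); rewrite mulrA.
  + apply/seteqP; split=> //; rewrite -yd -!mulrA mulrA.
    exact: lann_mul.
- case=> yy /seteqP[/lideal_subP[p wy] /lideal_subP[q dq]] /seteqP[yvd dyv].
  have dd : d = d * v * a * w * y.
    by rewrite {1}dq -{1}yy dq !mulrA.
  split=> //.
  + by apply: lann_fix yvd _; rewrite !mulrA yy.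
  (* Substituting [w * y = p * d] into [dd] gives [d] the inner inverse [v * a * p]. The factor
     [d * v * a * p] fixes [d] from the left, so it fixes [y * v] too, which puts [y * v] in
     [rideal d]. *)
  + have dr : d * v * a * p * d = d by rewrite -mulrA -wy mulrA -dd.
    apply/rideal_subP; exists (v * a * p * (y * v)).
    by rewrite -{1}(lann_fix dyv dr) !mulrA.
  + apply/seteqP; split; first by rewrite dq; exact: rann_mul.
    by rewrite wy; exact: rann_mul.
- case=> yd dy /rideal_subP[s ys] /seteqP[wyd dwy].
  split; last by apply/seteqP.
  (* Right multiplication by [v * a * w * y] fixes [d], hence [w * y]; the other equation follows
     from [y * v = d * s]. *)
  + apply: (invertible_cancel hvw).
      rewrite -[RHS](rann_fix (p := v * a * w * y) dwy) ?mulrA //.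
    by rewrite -mulrA ys mulrA -ys yd ys.
  + apply/seteqP; split; apply/rideal_subP; first by exists s.
    by exists (a * w * d); rewrite !mulrA.
- by case=> yy yvd wyd; split.
- case=> yy /seteqP[/rideal_subP[s ys] /rideal_subP[t dt]] /seteqP[dwy wyd].
  have yd : y * v * a * w * d = d by rewrite dt !mulrA yy.
  have dr : d * (s * a * w * d) = d by rewrite -[RHS]yd ys !mulrA.
  split=> //; first split.
  + by exists (s * a) => //; rewrite -[RHS]yy ys !mulrA.
  (* By [dr], [s * a * w * d] fixes [d] from the right, hence [w * y]; it is inserted after [w * y]
     in [y = y * v * a * w * y]. *)
  + exists (a * w * y * s * a * w) => //.
    transitivity (y * v * a * (w * y * (s * a * w * d))); first by rewrite !mulrA.
    by rewrite (rann_fix dwy dr) mulrA.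
  (* The opposite transfer: [v * a * w * y] fixes [w * y] from the right, hence [d]. *)
  + have := rann_fix (p := v * a * w * y) wyd; rewrite !mulrA; apply.
    by rewrite -[in RHS]yy !mulrA.
- case=> [[[r _ yr] [q _ yq]] yd dy]; split=> //.
  + by apply/lideal_subP; exists (w * (y * v * q)); rewrite -mulrA yq.
  + by apply/rideal_subP; exists (r * (w * y) * v); rewrite !mulrA -(mulrA (d * r)) yr.
Qed.
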